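(* If $T$ is a measure preserving transformation on a separable probability space, then $T$ is lightly mixing on a dense collection.
   Context: A transformation on a separable probability space $(X,\mathcal{B},\mu)$ is a measurable and invertible map $T:X\to X$; it is measure preserving if $\mu(T^{-1}A)=\mu(A)$ for each $A\in\mathcal{B}$. $\mathcal{B}$ is considered as a separable metric space with the distance $d(A,B)=\mu(A\triangle B)$, and dense means dense for $d$. $T$ is lightly mixing on a dense collection if there exists a dense subset $\mathcal{D}\subset\mathcal{B}$ such that $\liminf_{n\to\infty}\mu(T^nA\cap B)>0$ for all $A,B\in\mathcal{D}$ having positive measure.
   Formalization: The claim fails for finitely many atoms (two points of mass 1/2, T the identity), so spaces whose measure algebra is finite with at least two atoms are excluded; ''invertible'' is read as having a measurable inverse, so that T^nA is measurable. *)

(* Defs.v *)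
From HB Require Import structures.
From mathcomp Require Import all_boot all_order all_algebra.
From mathcomp Require Import all_classical all_reals all_analysis.

Set Implicit Arguments.
Unset Strict Implicit.
Unset Printing Implicit Defensive.

Import Order.TTheory GRing.Theory Num.Theory.
Local Open Scope classical_set_scope.
Local Open Scope ring_scope.
Local Open Scope ereal_scope.

Section definitions.
Context (d : measure_display) (X : measurableType d) (R : realType).
Implicit Types (P : probability X R) (T : X -> X) (D : set (set X)).

Definition sdist P (A B : set X) : \bar R := P (A `+` B).

Definition dense_collection P D : Prop :=
  D `<=` measurable /\
  forall A, measurable A -> forall e : R, (0 < e)%R ->
    exists2 B, D B & sdist P A B < e%:E.

Definition separable_probability P : Prop :=
  exists2 C : set (set X), countable C & dense_collection P C.

(* Invertible means invertible as a measurable map, so that the forward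
   images T^n A of measurable sets are measurable (automatic when X is a
   standard Borel space). *)
Definition transformation T : Prop :=
  measurable_fun [set: X] T /\
  exists S : X -> X,
    [/\ cancel T S, cancel S T & measurable_fun [set: X] S].

Definition measure_preserving P T : Prop :=
  forall A, measurable A -> P (T @^-1` A) = P A.

Definition lightly_mixing_on P T D : Prop :=
  forall A B, D A -> D B -> 0 < P A -> 0 < P B ->
    0 < limn_einf (fun n => P ((iter n T @` A) `&` B)).

Definition lightly_mixing_on_dense_collection P T : Prop :=
  exists2 D, dense_collection P D & lightly_mixing_on P T D.

Definition trivial_probability P : Prop :=
  forall A, measurable A -> P A = 0 \/ P A = 1.

(* Equivalently, the measure algebra of P is finite, i.e., up to null sets X
   is a finite union of atoms. *)
Definition bounded_away_from_zero P : Prop :=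
  exists2 e : R, (0 < e)%R &
    forall A, measurable A -> 0 < P A -> e%:E <= P A.

(* The measure algebra is not finite with more than one atom. This holds for
   every nonatomic P, and also for every P with infinitely many atoms, with
   both an atomic and a nonatomic part, or with values in {0, 1}. When it
   fails, a dense collection contains every measurable set up to null sets,
   hence each of the atoms, and no T is lightly mixing on it: if p != q are
   atoms, T^n p cannot meet both p and q in positive measure. *)
Definition not_finitely_atomic P : Prop :=
  bounded_away_from_zero P -> trivial_probability P.

End definitions.

(* Main.v *)
Require Import Defs.
From mathcomp Require Import all_boot all_order all_algebra.
From mathcomp Require Import all_classical all_reals all_analysis.

(** Every dense collection D below is closed under measurable supersets, so
that its density only asks for members of arbitrarily small measure
([dense_collection_upward]): A is approximated by its union with a small
member of D.  The point is to find small sets that T^n never separates.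

A probability whose positive measures are bounded away from zero is, by
hypothesis, {0, 1}-valued, and then all measurable sets form a suitable
collection.  Otherwise there are sets of arbitrarily small positive measure,
and one of two things happens.

If such small sets can be chosen invariant, take invariant Z_n with
P(Z_n) < 2^-(n+1), and let D consist of the sets that contain all but
finitely many Z_n.  Two members share some Z_n, and T^n moves no point out of
it ([lightly_mixing_small_invariant]).

If the positive measures of invariant sets are at least some delta > 0, then
cutting the space into invariant pieces stops after at most 1/delta cuts.
Keeping at each cut a piece that still has arbitrarily small subsets yields an
ergodic invariant set Y with arbitrarily small subsets ([exists_ergodic]).
Let D consist of the sets A that are, relative to Y, both

  - syndetic: for some N, every point of Y enters A in fewer than N steps;
  - thick: for every N there is a set of positive measure in Y whose points
    stay in A during their first N steps.

If A is syndetic with constant N and E witnesses that B is thick for N, then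
each point x of E is T^n z with z in Y, and z enters A within N steps while x
stays in B.  Hence E is covered by N preimages of the intersection of
T^n A and B, whose measure is thus at least P(E)/N for all n
([syndetic_thick_limn_einf]).

Both kinds of set can be small.  If A in Y has small positive measure,
ergodicity makes the points of Y that do not enter A within N steps negligible
for large N; adding these points to A gives a small syndetic set
([exists_small_syndetic]).  A union of very long orbit segments of very small
sets is thick and small ([exists_small_thick]).  The union of the two is a
small member of D. *)

Set Implicit Arguments.
Unset Strict Implicit.
Unset Printing Implicit Defensive.

Import Order.TTheory GRing.Theory Num.Theory.
Local Open Scope classical_set_scope.
Local Open Scope ring_scope.
Local Open Scope ereal_scope.

(** * Measure estimates *)

Lemma limn_einf_gt0 (R : realType) (u : (\bar R)^nat) (c : \bar R) :
  0 < c -> (forall n, c <= u n) -> 0 < limn_einf u.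
Proof.
move=> c0 cu; apply: (lt_le_trans c0); rewrite limn_einf_lim.
apply: lime_ge; first exact: is_cvg_einfs.
by apply: nearW => n; apply: le_ereal_inf_tmp => _ [m _ <-].
Qed.

Lemma preimage_iterSr (X : Type) (f : X -> X) n (A : set X) :
  iter n.+1 f @^-1` A = f @^-1` (iter n f @^-1` A).
Proof. by apply/seteqP; split=> x; rewrite /preimage /= -iterS iterSr. Qed.

Section probability.
Context (d : measure_display) (X : measurableType d) (R : realType).
Variable P : probability X R.
Implicit Types (A B Y Z : set X) (D : set (set X)).

Definition contains_small_sets Y : Prop :=
  forall e : R, (0 < e)%R ->
    exists A, [/\ measurable A, A `<=` Y, 0 < P A & P A < e%:E].

Lemma probability_bigcup_geometric (F : (set X)^nat) (e : R) : (0 <= e)%R ->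
  (forall n, measurable (F n)) ->
  (forall n, P (F n) <= (e / (2 ^ n.+1)%:R)%:E) ->
  P (\bigcup_n F n) <= e%:E.
Proof.
move=> e0 mF Fe; apply: le_trans (epsilon_trick0 xpredT e0).
apply: le_trans (measure_sigma_subadditive P mF _ (@subset_refl _ _)) _.
  exact: bigcup_measurable.
by apply: lee_nneseries => *; [exact: measure_ge0|exact: Fe].
Qed.

Lemma probability_bigcup_ord (F : (set X)^nat) N (c : R) :
  (forall i, measurable (F i)) -> (forall i, P (F i) <= c%:E) ->
  P (\bigcup_(i < N) F i) <= (c *+ N)%:E.
Proof.
move=> mF Fc.
apply: (@le_trans _ _ (\sum_(i < N) P (F i))).
  apply: (content_subadditive P) => //; first exact: bigcup_measurable.
  by rewrite bigcup_mkord.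
rewrite -[X in (_ *+ X)%R]card_ord -sumr_const -sumEFin.
by apply: lee_sum => i _; exact: Fc.
Qed.

(** For H in D, the symmetric difference of A and its superset A u H lies in
H, so that A is approximated by a member of D as well as H is small. *)
Lemma dense_collection_upward D : D `<=` measurable ->
  (forall A B, D A -> measurable B -> A `<=` B -> D B) ->
  (forall e : R, (0 < e)%R -> exists2 H, D H & P H <= e%:E) ->
  dense_collection P D.
Proof.
move=> Dm Dup Dsmall; split=> // A mA e e0.
have [H DH He] := Dsmall _ (divr_gt0 e0 (ltr0n _ 2)).
have mH := Dm _ DH.
exists (A `|` H); first by apply: (Dup H) => //; exact: measurableU.
apply: (@le_lt_trans _ _ (e / 2)%:E).
  apply: le_trans He; apply: le_measure; rewrite ?inE//.
    rewrite setY_def; apply: measurableU; apply: measurableD => //;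
      exact: measurableU.
  by rewrite setY_def => x [[Ax []]|[[//|//] nA]]; left.
by rewrite lte_fin ltr_pdivrMr// ltr_pMr// ltr1n.
Qed.

Lemma contains_small_sets_setT :
  ~ bounded_away_from_zero P -> contains_small_sets [set: X].
Proof.
move=> nb e e0; apply: contrapT => ne; apply: nb; exists e => // A mA A0.
by rewrite leNgt; apply/negP => Ae; apply: ne; exists A.
Qed.

Lemma measure_lb_not_contains_small_sets Z : measurable Z ->
  ~ contains_small_sets Z -> exists2 e : R, (0 < e)%R &
    forall A, measurable A -> 0 < P (A `&` Z) -> e%:E <= P A.
Proof.
move=> mZ /existsNP[e /not_implyP[e0 ne]]; exists e => // A mA AZ0.
rewrite leNgt; apply/negP => Ae; apply: ne; exists (A `&` Z); split => //.
- exact: measurableI.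
- exact: (le_lt_trans (measureIl _ mA mZ)).
Qed.

(** Whichever way Y is cut in two, one of the pieces inherits small subsets:
two positive lower bounds, one for each piece, would combine into a lower
bound for the positive subsets of Y. *)
Lemma contains_small_setsD Y Z : measurable Y -> measurable Z ->
  contains_small_sets Y ->
  contains_small_sets Z \/ contains_small_sets (Y `\` Z).
Proof.
move=> mY mZ sY; apply: contrapT => /not_orP[].
move=> /(measure_lb_not_contains_small_sets mZ)[e1 e10 H1].
move=> /(measure_lb_not_contains_small_sets (measurableD mY mZ))[e2 e20 H2].
have [|A [mA AY A0 Ae]] := sY (Num.min e1 e2); first by rewrite lt_min e10.
move: Ae; rewrite EFin_min lt_min => /andP[Ae1 Ae2].
have /eqP AZ0 : P (A `&` Z) == 0.
  by apply/contraT => nz; rewrite ltNge H1// lt0e nz measure_ge0 in Ae1.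
have /eqP AYZ0 : P (A `&` (Y `\` Z)) == 0.
  by apply/contraT => nz; rewrite ltNge H2// lt0e nz measure_ge0 in Ae2.
have AE : P A = P (A `\` Z) + P (A `&` Z) := measureDI P mA mZ.
move: A0; rewrite AE AZ0 adde0.
suff -> : A `\` Z = A `&` (Y `\` Z) by rewrite AYZ0 ltxx.
by rewrite setIDA (setIidl AY).
Qed.

End probability.

(** * Invertible measure preserving maps *)

Section dynamics.
Context (d : measure_display) (X : measurableType d) (R : realType).
Variables (P : probability X R) (T S : X -> X).
Hypotheses (TK : cancel T S) (SK : cancel S T).
Hypotheses (mT : measurable_fun [set: X] T) (mS : measurable_fun [set: X] S).
Hypothesis T_preserving : measure_preserving P T.
Implicit Types (A B Y Z W : set X).

Lemma iterTK n : cancel (iter n T) (iter n S).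
Proof. by elim: n => // n IH x; rewrite iterSr iterS TK IH. Qed.

Lemma iterSK n : cancel (iter n S) (iter n T).
Proof. by elim: n => // n IH x; rewrite iterSr iterS SK IH. Qed.

Lemma image_iter n A : iter n T @` A = iter n S @^-1` A.
Proof.
apply/seteqP; split=> [_ [x Ax <-]|x Ax]; first by rewrite /= iterTK.
by exists (iter n S x); rewrite ?iterSK.
Qed.

Lemma measurable_preimage_iter n A :
  measurable A -> measurable (iter n T @^-1` A).
Proof.
move=> mA; elim: n => [//|n IH].
by have := mT measurableT IH; rewrite setTI preimage_iterSr.
Qed.

Lemma measurable_image_iter n A : measurable A -> measurable (iter n T @` A).
Proof.
move=> mA; rewrite image_iter; elim: n => [//|n IH].
by have := mS measurableT IH; rewrite setTI preimage_iterSr.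
Qed.

Lemma probability_preimage_iter n A :
  measurable A -> P (iter n T @^-1` A) = P A.
Proof.
move=> mA; elim: n => [//|n <-].
by rewrite preimage_iterSr (T_preserving (measurable_preimage_iter n mA)).
Qed.

Lemma probability_image_iter n A : measurable A -> P (iter n T @` A) = P A.
Proof.
move=> mA; rewrite -(probability_preimage_iter n (measurable_image_iter n mA)).
rewrite image_iter -comp_preimage; congr (P _).
by apply/seteqP; split => x /=; rewrite iterTK.
Qed.

Definition invariant Z : Prop := measurable Z /\ T @^-1` Z = Z.

Lemma invariant_preimage_iter n Z : invariant Z -> iter n T @^-1` Z = Z.
Proof.
by move=> [_ TZ]; elim: n => [//|n IH]; rewrite preimage_iterSr IH.
Qed.

Lemma invariant_image_iter n Z : invariant Z -> iter n T @` Z = Z.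
Proof.
move=> iZ; rewrite image_iter -{1}(invariant_preimage_iter n iZ) -comp_preimage.
by apply/seteqP; split => x /=; rewrite iterSK.
Qed.

Lemma invariantD Y Z : invariant Y -> invariant Z -> invariant (Y `\` Z).
Proof.
move=> [mY TY] [mZ TZ]; split; first exact: measurableD.
by rewrite -[in RHS]TY -[in RHS]TZ.
Qed.

(** The core is the set of points that are in T^-n W for all n.  These
preimages decrease and all have the measure of W.  This upgrades
sub-invariance, the natural property of a set swept out by preimages, to the
invariance under which the complement is also invariant. *)
Lemma subinvariant_core W : measurable W -> T @^-1` W `<=` W ->
  exists Z, [/\ invariant Z, Z `<=` W & P Z = P W].
Proof.
move=> mW TW; pose F n := iter n T @^-1` W.
have mF n : measurable (F n) by exact: measurable_preimage_iter.
have FS n : F n.+1 `<=` F n.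
  by move=> x; rewrite /F /= -/(iter n.+1 T x) => /TW.
have mZ : measurable (\bigcap_n F n) by apply: bigcap_measurable => //; exists 0%N.
exists (\bigcap_n F n); split.
- split => //; apply/seteqP; split=> x Zx n _.
    by apply: FS; have := Zx n I; rewrite /F /= -iterSr.
  by have := Zx n.+1 I; rewrite /F /= -iterS iterSr.
- by move=> x /(_ 0%N I).
- have nF : {homo F : n m / (n <= m)%N >-> (m <= n)%O}.
    by apply/nonincreasing_seqP => n; apply/subsetPset.
  have F0 : P (F 0%N) < +oo by rewrite ltey_eq fin_num_measure.
  have := nonincreasing_cvg_mu F0 mF mZ nF.
  rewrite (_ : P \o F = cst (P W)); last first.
    by apply/funext => n /=; rewrite probability_preimage_iter.
  by move=> /(cvg_lim (@ereal_hausdorff R)) <-; rewrite lim_cst.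
Qed.

(** * Trivial probabilities and small invariant sets *)

(** Two sets of full measure meet in a set of full measure. *)
Lemma lightly_mixing_trivial :
  trivial_probability P -> lightly_mixing_on_dense_collection P T.
Proof.
move=> trivP; exists measurable.
  split=> // A mA e e0; exists A => //.
  by rewrite /sdist setYE setUid setIid setDv measure0 lte_fin.
have full A : measurable A -> 0 < P A -> P A = 1.
  by move=> mA; case: (trivP _ mA) => [->|//]; rewrite ltxx.
move=> A B mA mB A0 B0; apply: (@limn_einf_gt0 _ _ 1); first exact: lte01.
move=> n; have mTA := measurable_image_iter n mA.
have TA1 : P (iter n T @` A) = 1 by rewrite probability_image_iter// full.
have TAE : P (iter n T @` A) = _ := measureDI P mTA mB.
rewrite -TA1 TAE geeDr//.
have <- : P (~` B) = 0 by rewrite probability_setC// full// subee.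
apply: le_measure; rewrite ?inE; [exact: measurableD|exact: measurableC|].
by move=> x [].
Qed.

(** Members of the collection contain a tail of one and the same sequence of
small invariant sets, which makes any two of them intersect. *)
Lemma lightly_mixing_small_invariant :
  (forall e : R, (0 < e)%R -> exists Z, [/\ invariant Z, 0 < P Z & P Z < e%:E]) ->
  lightly_mixing_on_dense_collection P T.
Proof.
move=> small.
have [n|Z HZ] := @choice _ _ (fun n Z =>
    [/\ invariant Z, 0 < P Z & P Z < (1 / (2 ^ n.+1)%:R)%:E]).
  by apply: small; rewrite divr_gt0// ltr0n expn_gt0.
have mZ n : measurable (Z n) by have [[]] := HZ n.
exists [set A | measurable A /\ exists k, forall n, Z (k + n)%N `<=` A].
  apply: dense_collection_upward.
  - by move=> A [].
  - move=> A B [_ [k ZA]] mB AB; split => //; exists k => n.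
    exact: subset_trans (ZA n) AB.
  (* The tail from k on has measure at most 2^-k, and k > 1/e. *)
  move=> e e0; pose k := Num.bound e^-1.
  exists (\bigcup_n Z (k + n)%N).
    split; first exact: bigcup_measurable.
    by exists k => n; exact: (bigcup_sup (F := fun n => Z (k + n)%N)).
  apply: probability_bigcup_geometric => [|//|n]; first exact: ltW.
  have [_ _ /ltW/le_trans] := HZ (k + n)%N; apply.
  rewrite lee_fin -addnS expnD natrM invfM mul1r.
  rewrite ler_pM2r ?invr_gt0 ?ltr0n ?expn_gt0//.
  rewrite -[leRHS]invrK lef_pV2 ?posrE ?invr_gt0 ?ltr0n ?expn_gt0//.
  apply: ltW; apply: lt_le_trans (archi_boundP _) _; first by rewrite invr_ge0 ltW.
  by rewrite ler_nat ltnW// ltn_expl.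
move=> A B [mA [k ZA]] [mB [l ZB]] _ _.
have [iZ Z0 _] := HZ (k + l)%N.
apply: (limn_einf_gt0 Z0) => n; apply: le_measure; rewrite ?inE//.
  by apply: measurableI => //; exact: measurable_image_iter.
rewrite subsetI; split; last by rewrite addnC.
by rewrite -(invariant_image_iter n iZ); exact: image_subset.
Qed.

(** * Existence of an ergodic set with small subsets *)

Definition ergodic_on Y : Prop :=
  forall Z, invariant Z -> Z `<=` Y -> 0 < P Z -> P (Y `\` Z) = 0.

(** Cutting a non-ergodic set into two invariant pieces removes at least delta
from either of them, so a piece with small subsets reached after n cuts has
measure at most 1 - n delta; there are only finitely many cuts. *)
Lemma exists_ergodic (delta : R) : (0 < delta)%R ->
  (forall Z, invariant Z -> 0 < P Z -> delta%:E <= P Z) ->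
  contains_small_sets P [set: X] ->
  exists Y, [/\ invariant Y, contains_small_sets P Y & ergodic_on Y].
Proof.
move=> delta0 deltaP smallT; apply: contrapT => none.
have desc n : exists Y, [/\ invariant Y, contains_small_sets P Y &
    P Y <= (1 - delta *+ n)%:E].
  elim: n => [|n [Y [iY sY Yn]]].
    exists setT; split => //; by [split|rewrite subr0 probability_setT].
  have [Z [iZ ZY Z0 YZ0]] : exists Z,
      [/\ invariant Z, Z `<=` Y, 0 < P Z & 0 < P (Y `\` Z)].
    apply: contrapT => nZ; apply: none; exists Y; split => // Z iZ ZY Z0.
    apply/eqP; apply: contraT => YZ; exfalso; apply: nZ; exists Z; split => //.
    by rewrite lt0e YZ measure_ge0.
  have iYZ := invariantD iY iZ.
  have YE : P Y = P (Y `\` Z) + P Z.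
    by rewrite -[X in _ + P X](setIidr ZY); exact: (measureDI P iY.1 iZ.1).
  (* Stated for either piece, as the piece with small subsets is not known. *)
  have bound V V' : invariant V' -> 0 < P V' -> P V + P V' = P Y ->
      P V <= (1 - delta *+ n.+1)%:E.
    move=> iV' V'0 VE; rewrite mulrSr opprD addrA EFinB leeBrDr//.
    by apply: le_trans Yn; rewrite -VE leeD2l// deltaP.
  have [sZ|sYZ] := contains_small_setsD iY.1 iZ.1 sY.
    by exists Z; split => //; apply: (bound _ (Y `\` Z)) => //; rewrite addeC.
  by exists (Y `\` Z); split => //; apply: (bound _ Z).
have [Y [_ _]] := desc (Num.bound delta^-1); apply/negP; rewrite -ltNge.
apply: lt_le_trans (measure_ge0 P Y); rewrite lte_fin subr_lt0 -mulr_natr.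
by rewrite -ltr_pdivrMl// mulr1; apply: archi_boundP; rewrite invr_ge0 ltW.
Qed.

(** * Syndetic and thick sets *)

Definition syndetic_in Y A : Prop :=
  exists N, Y `<=` \bigcup_(i < N) iter i T @^-1` A.

Definition thick_in Y A : Prop :=
  forall N, exists B, [/\ measurable B, B `<=` Y, 0 < P B &
    forall i, (i < N)%N -> B `<=` iter i T @^-1` A].

(** The bound P(E)/N is uniform in n because the constant N of the syndetic
set depends neither on n nor on the point T^-n x from which A is sought. *)
Lemma syndetic_thick_limn_einf Y A B : invariant Y ->
  measurable A -> measurable B -> syndetic_in Y A -> thick_in Y B ->
  0 < limn_einf (fun n => P (iter n T @` A `&` B)).
Proof.
move=> iY mA mB [N YA] /(_ N)[E [mE EY E0 EB]].
have N0 : (0 < N)%N.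
  rewrite lt0n; apply/eqP => N0; move: YA E0; rewrite N0 bigcup_mkord big_ord0 => Y0.
  have -> : E = set0 by rewrite -subset0; exact: subset_trans EY Y0.
  by rewrite measure0 ltxx.
have Efin : P E \is a fin_num by exact: fin_num_measure.
apply: (@limn_einf_gt0 _ _ (fine (P E) / N%:R)%:E).
  by rewrite lte_fin divr_gt0 ?ltr0n// fine_gt0// E0 ltey_eq Efin.
move=> n; set C := _ `&` _.
have mC : measurable C by apply: measurableI => //; exact: measurable_image_iter.
have Cfin : P C \is a fin_num by exact: fin_num_measure.
have EC : E `<=` \bigcup_(i < N) iter i T @^-1` C.
  move=> x Ex; have : (iter n T @` Y) x.
    by rewrite (invariant_image_iter n iY); exact: EY.
  case=> z /YA[i iN Az] zx; exists i => //; split; last exact: EB Ex.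
  by exists (iter i T z) => //; rewrite -zx -!iterD addnC.
rewrite -(fineK Cfin) lee_fin ler_pdivrMr ?ltr0n// mulr_natr -lee_fin fineK//.
have mTC i : measurable (iter i T @^-1` C) by exact: measurable_preimage_iter.
apply: (@le_trans _ _ (P (\bigcup_(i < N) iter i T @^-1` C))).
  by apply: le_measure; rewrite ?inE//; exact: bigcup_measurable.
apply: probability_bigcup_ord => // i.
by rewrite fineK// probability_preimage_iter.
Qed.

(** The points that enter A form a sub-invariant set, whose invariant core has
the same positive measure and hence exhausts an ergodic set up to a null set. *)
Lemma ergodic_sweep Y A : invariant Y -> ergodic_on Y ->
  measurable A -> A `<=` Y -> 0 < P A ->
  P (Y `\` \bigcup_i iter i T @^-1` A) = 0.
Proof.
move=> iY eY mA AY A0; set W := \bigcup_i _.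
have mW : measurable W.
  by apply: bigcup_measurable => i _; exact: measurable_preimage_iter.
have AW : A `<=` W by move=> x Ax; exists 0%N.
have [|Z [iZ ZW PZ]] := subinvariant_core mW.
  by move=> x [i _ Ax]; exists i.+1 => //; rewrite /= -iterS iterSr.
have WY : W `<=` Y.
  by move=> x [i _ /AY]; rewrite -[Y in X in _ -> X](invariant_preimage_iter i iY).
apply/eqP; rewrite eq_le measure_ge0 andbT -(eY Z) //.
- apply: le_measure; rewrite ?inE; last exact: setDS.
    by apply: measurableD => //; exact: iY.1.
  by apply: measurableD; [exact: iY.1|exact: iZ.1].
- exact: subset_trans ZW WY.
- by rewrite PZ; apply: lt_le_trans A0 _; apply: le_measure; rewrite ?inE.
Qed.

(** Almost every point of Y enters a given small A; those that take more than
N steps have a measure that tends to 0 with N, and can be added to A. *)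
Lemma exists_small_syndetic Y (e : R) : invariant Y -> ergodic_on Y ->
  contains_small_sets P Y -> (0 < e)%R ->
  exists G, [/\ measurable G, syndetic_in Y G & P G <= e%:E].
Proof.
move=> iY eY sY e0; have e20 : (0 < e / 2)%R by rewrite divr_gt0.
have [A [mA AY A0 Ae]] := sY _ e20.
pose F N := Y `\` \bigcup_(i < N) iter i T @^-1` A.
have mF N : measurable (F N).
  apply: measurableD; first exact: iY.1.
  by apply: bigcup_measurable => i _; exact: measurable_preimage_iter.
have [N FN] : exists N, P (F N) < (e / 2)%:E.
  apply: contrapT => /forallNP nF.
  have nincF : {homo F : n m / (n <= m)%N >-> (m <= n)%O}.
    apply/nonincreasing_seqP => n; apply/subsetPset => x [Yx nA].
    by split=> // -[i /= iN Ax]; apply: nA; exists i => //; exact: leqW.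
  have F0 : P (F 0%N) < +oo by rewrite ltey_eq fin_num_measure.
  have mcap : measurable (\bigcap_n F n).
    by apply: bigcap_measurable => //; exists 0%N.
  have capE : \bigcap_n F n = Y `\` \bigcup_i iter i T @^-1` A.
    apply/seteqP; split=> [x Fx|x [Yx nA] n _].
      split; first by have [] := Fx 0%N I.
      by move=> [i _ Ax]; have [_] := Fx i.+1 I; apply; exists i => /=.
    by split=> // -[i _ Ax]; apply: nA; exists i.
  have cvgF : P \o F @ \oo --> 0.
    rewrite -(ergodic_sweep iY eY mA AY A0) -capE.
    exact: nonincreasing_cvg_mu.
  have : (e / 2)%:E <= limn (P \o F).
    apply: lime_ge; first by apply/cvg_ex; exists 0.
    by apply: nearW => n /=; rewrite leNgt; exact/negP.
  by rewrite (cvg_lim (@ereal_hausdorff R) cvgF) lee_fin leNgt e20.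
exists (A `|` F N); split; first exact: measurableU.
  (* N may be 0, whereas the added points need the 0-th preimage. *)
  exists N.+1 => x Yx.
  have [[i iN Ax]|nA] := pselect ((\bigcup_(i < N) iter i T @^-1` A) x).
    by exists i; [exact: ltnW|left].
  by exists 0%N => //; right.
apply: le_trans (measureU2 _ mA (mF N)) _.
by rewrite [e]splitr EFinD leeD// ltW.
Qed.

(** The m-th orbit segment has m + 1 steps, so its base is taken so small that
these m + 1 images together have measure at most e / 2^(m + 1). *)
Lemma exists_small_thick Y (e : R) : contains_small_sets P Y -> (0 < e)%R ->
  exists F, [/\ measurable F, thick_in Y F & P F <= e%:E].
Proof.
move=> sY e0.
have [m|B HB] := @choice _ _ (fun m B => [/\ measurable B, B `<=` Y, 0 < P B &
    P B < (e / (2 ^ m.+1)%:R / m.+1%:R)%:E]).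
  by apply: sY; rewrite !divr_gt0// ltr0n ?expn_gt0.
have mTB m i : measurable (iter i T @` B m).
  by apply: measurable_image_iter; have [] := HB m.
pose F m := \bigcup_(i < m.+1) iter i T @` B m.
have mF m : measurable (F m) by exact: bigcup_measurable.
exists (\bigcup_m F m); split; first exact: bigcup_measurable.
  move=> N; have [mB BY B0 _] := HB N; exists (B N); split=> // i iN x Bx.
  by exists N => //; exists i; [exact: ltnW|exists x].
apply: probability_bigcup_geometric => //; first exact: ltW.
move=> m; have [mB _ _ /ltW Bm] := HB m.
have -> : (e / (2 ^ m.+1)%:R = e / (2 ^ m.+1)%:R / m.+1%:R *+ m.+1)%R.
  by rewrite -[RHS]mulr_natr divfK// pnatr_eq0.
by apply: probability_bigcup_ord => // i; rewrite probability_image_iter.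
Qed.

Lemma lightly_mixing_ergodic Y : invariant Y -> ergodic_on Y ->
  contains_small_sets P Y -> lightly_mixing_on_dense_collection P T.
Proof.
move=> iY eY sY.
exists [set A | [/\ measurable A, syndetic_in Y A & thick_in Y A]]; last first.
  by move=> A B [mA sA _] [mB _ tB] _ _; exact: (syndetic_thick_limn_einf iY).
apply: dense_collection_upward.
- by move=> A [].
- move=> A B [_ [N YA] tA] mB AB; split => //.
    exists N; apply: subset_trans YA _.
    by apply: subset_bigcup => i _; exact: preimage_subset.
  move=> M; have [C [mC CY C0 CA]] := tA M; exists C; split => // i iM.
  by apply: subset_trans (CA i iM) _; exact: preimage_subset.
move=> e e0; have e20 : (0 < e / 2)%R by rewrite divr_gt0.
have [G [mG [N YG] Ge]] := exists_small_syndetic iY eY sY e20.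
have [F [mF tF Fe]] := exists_small_thick sY e20.
exists (G `|` F); last first.
  by apply: le_trans (measureU2 _ mG mF) _; rewrite [e]splitr EFinD leeD.
split; first exact: measurableU.
  exists N; apply: subset_trans YG _.
  by apply: subset_bigcup => i _ x; left.
move=> M; have [C [mC CY C0 CF]] := tF M; exists C; split => // i iM x Cx.
by right; exact: CF Cx.
Qed.

End dynamics.

Theorem theorem3p3 (R : realType) (d : measure_display) (X : measurableType d)
  (P : probability X R) (T : X -> X)
  (P_separable : separable_probability P)
  (P_not_finite : not_finitely_atomic P)
  (T_transformation : transformation T)
  (T_preserving : measure_preserving P T) :
  lightly_mixing_on_dense_collection P T.
Proof.
have [mT [S [TK SK mS]]] := T_transformation.
have [/P_not_finite trivP|/contains_small_sets_setT smallT] :=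
  pselect (bounded_away_from_zero P).
  exact: (lightly_mixing_trivial TK SK).
have [small|/existsNP[delta /not_implyP[delta0 noZ]]] := pselect (forall e : R,
    (0 < e)%R -> exists Z, [/\ invariant T Z, 0 < P Z & P Z < e%:E]).
  exact: (lightly_mixing_small_invariant TK SK).
have [|Y [iY sY eY]] := exists_ergodic delta0 _ smallT (T := T).
  move=> Z iZ Z0; rewrite leNgt; apply/negP => Zd.
  by apply: noZ; exists Z.
exact: (lightly_mixing_ergodic TK SK mT mS T_preserving iY eY sY).
Qed.
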